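(* Let $n,m\ge1$, $d=n+\binom n2$. Suppose agents $b\in[m]$ have valuations $v^b$ that bid on cliques $K_{S^b}$, $S^b\subseteq[n]$, forming a covering, i.e. $\bigcup_{b=1}^m S^b=[n]$. Then for every bundle $a^*\in\{0,1\}^n$ there is a competitive equilibrium with anonymous graphical pricing at $a^*$: there exist $p\in\mathbb{R}^d$ and $a^1,\dots,a^m\in\{a_S:S\subseteq[n]\}$ with $a^b\in D(v^b,p)$ for all $b$ and $\pi\big(\sum_b a^b\big)=a^*$.
   Context: Vectors in $\mathbb{R}^d$ are indexed by $[n]\sqcup\binom{[n]}{2}$. For $S\subseteq[n]$, $a_S\in\{0,1\}^d$ has $a_{S,i}=1$ iff $i\in S$ and $a_{S,ij}=1$ iff $i,j\in S$. An agent bids on the clique $K_{S^b}$ if their valuation is $v^b(S)=\sum_{i\in S}w^b_i+\sum_{\{i,j\}\subseteq S}w^b_{ij}$ for $S\subseteq S^b$, with real weights $w^b$ on the vertices and edges of $K_{S^b}$, and $v^b(S)=-\infty$ whenever $S\not\subseteq S^b$ (weight $-\infty$ on vertices outside $S^b$). A price $p\in\mathbb{R}^d$ charges every agent $\langle p,a_S\rangle$ for bundle $S$. $D(v,p)=\{a_S: S\in\arg\max_{S\subseteq[n]}(v(S)-\langle p,a_S\rangle)\}$. $\pi:\mathbb{R}^d\to\mathbb{R}^n$ is projection onto the vertex coordinates. *)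

(* Defs.v *)
From mathcomp Require Import all_boot all_order all_algebra.
From mathcomp Require Import classical_sets constructive_ereal reals.

Set Implicit Arguments.
Unset Strict Implicit.
Unset Printing Implicit Defensive.

Import Order.TTheory GRing.Theory Num.Theory.

Local Open Scope ring_scope.

Notation edge n := {e : {set 'I_n} | #|e| == 2}.

Notation coord n := ('I_n + edge n)%type.

Lemma card_coord (n : nat) : #|{: coord n}| = (n + 'C(n, 2))%N.
Proof.
rewrite card_sum card_ord card_sig; congr (_ + _)%N.
by rewrite -[in RHS](card_ord n) -card_draws cardsE.
Qed.

(* R^d, with d = #|coord n| = n + 'C(n, 2) by card_coord. *)
Notation gvec R n := {ffun coord n -> R}.

Definition bundle_vec (R : realType) (n : nat) (S : {set 'I_n}) : gvec R n :=
  [ffun c : coord n => match c return R with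
             | inl i => (i \in S)%:R
             | inr e => (val e \subset S)%:R
             end].

Definition dotv (R : realType) (n : nat) (p a : gvec R n) : R :=
  \sum_c p c * a c.

Definition vertex_proj (R : realType) (n : nat) (a : gvec R n) :
    {ffun 'I_n -> R} :=
  [ffun i => a (inl i)].

(* The entries of w at vertices and edges outside the clique on Sb are
   irrelevant: they occur in none of the sums over S \subset Sb. *)
Definition bids_on_clique (R : realType) (n : nat)
    (v : {set 'I_n} -> \bar R) (Sb : {set 'I_n}) : Prop :=
  exists w : gvec R n, forall S : {set 'I_n},
    v S = if S \subset Sb
          then (\sum_(i in S) w (inl i)
                + \sum_(e : edge n | val e \subset S) w (inr e))%:E
          else -oo%E.

Definition utility (R : realType) (n : nat) (v : {set 'I_n} -> \bar R)
    (p : gvec R n) (S : {set 'I_n}) : \bar R :=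
  (v S - (dotv p (bundle_vec R S))%:E)%E.

Definition demand (R : realType) (n : nat) (v : {set 'I_n} -> \bar R)
    (p : gvec R n) : set (gvec R n) :=
  (@bundle_vec R n
     @` [set S : {set 'I_n} | forall T, utility v p T <= utility v p S]%E)%classic.

Definition has_graphical_equilibrium (R : realType) (n m : nat)
    (v : 'I_m -> {set 'I_n} -> \bar R) (astar : {ffun 'I_n -> R}) : Prop :=
  exists (p : gvec R n) (a : 'I_m -> gvec R n),
    [/\ forall b, range (@bundle_vec R n) (a b),
        forall b, demand (v b) p (a b)
      & vertex_proj (\sum_(b < m) a b) = astar].

(* Main.v *)
(* Take an allocation of the support T of a^* to the agents that maximizes
   welfare among those giving each agent a part inside their clique.
   Since edge supply is unconstrained, edges inside a part can be heavily
   subsidized, edges between parts heavily taxed, and vertex prices adjusted so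
   that each part costs nothing extra; then every agent demands at most one
   part, and a whole one.  What is left is an assignment problem between agents
   and parts.  By efficiency, reassigning the parts along a permutation does not
   increase welfare, so the exchange graph has no closed walk of positive
   weight, and suprema of walk weights give prices for the parts. *)
Require Import Defs.
From mathcomp Require Import boolp classical_sets constructive_ereal reals.
From mathcomp Require Import all_boot all_order all_fingroup all_algebra.
From mathcomp Require Import zify lra.

Set Implicit Arguments.
Unset Strict Implicit.
Unset Printing Implicit Defensive.

Import Order.TTheory GRing.Theory Num.Theory.

Local Open Scope ring_scope.

(** * Closed walks and potentials *)

Lemma not_uniq_split (T : eqType) (s : seq T) : ~~ uniq s ->
  exists z s1 s2 s3, s = s1 ++ z :: s2 ++ z :: s3.
Proof.
elim: s => [//|a s IH] /=; rewrite negb_and negbK => /orP[|/IH].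
  by case/splitPr=> s2 s3; exists a, [::], s2, s3.
by move=> [z [s1 [s2 [s3 ->]]]]; exists z, (a :: s1), s2, s3.
Qed.

Section Potentials.
Variables (R : realType) (T : finType) (W : T -> T -> R).

Fixpoint walk_weight (x : T) (s : seq T) : R :=
  if s is y :: s' then W x y + walk_weight y s' else 0.

Lemma walk_weight_cat x s t :
  walk_weight x (s ++ t) = walk_weight x s + walk_weight (last x s) t.
Proof. by elim: s x => [|y s IH] x /=; rewrite ?add0r // IH addrA. Qed.

Lemma walk_weight_nth x0 x s :
  walk_weight x s = \sum_(i < size s) W (nth x0 (x :: s) i) (nth x0 s i).
Proof.
elim: s x => [|y s IH] x; first by rewrite big_ord0.
by rewrite big_ord_recl /= IH.
Qed.

Hypothesis W_refl : forall x, W x x = 0.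
Hypothesis W_perm : forall t : {perm T}, \sum_x W x (t x) <= 0.

(** The successor map of a simple cycle, extended by the identity, is a permutation; points off the
    cycle contribute nothing by [W_refl]. *)
Lemma cycle_weight_le0 x s : uniq (x :: s) -> walk_weight x (rcons s x) <= 0.
Proof.
move=> Us; pose c := x :: s.
have next_inj : injective (next c) := can_inj (prev_next Us).
apply: le_trans (W_perm (perm next_inj)).
rewrite (bigID (mem c)) /= [X in _ + X]big1 => [|y yc]; last first.
  by rewrite permE next_nth (negbTE yc) W_refl.
rewrite addr0 -(big_uniq _ Us) (big_nth x) big_mkord.
rewrite (walk_weight_nth x) size_rcons.
rewrite le_eqVlt; apply/orP; left; apply/eqP/eq_bigr => -[i /= lt_i] _.
rewrite permE next_nth mem_nth // index_uniq // -rcons_cons nth_rcons lt_i.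
congr (W _ _); rewrite nth_rcons.
by move: lt_i; rewrite ltnS leq_eqVlt => /predU1P[->|->] //; rewrite ltnn eqxx nth_default.
Qed.

(* A repeated vertex splits a closed walk into two shorter ones. *)
Lemma closed_walk_weight_le0 x s : walk_weight x (rcons s x) <= 0.
Proof.
have [k] := ubnP (size s); elim: k x s => // k IH x s; rewrite ltnS => le_s.
have [/cycle_weight_le0 //|/not_uniq_split] := boolP (uniq (x :: s)).
move=> [z [[|y s1] [s2 [s3]]]] /= [-> Es].
  move: le_s; rewrite Es size_cat /= => le_s.
  rewrite rcons_cat rcons_cons -cat_rcons walk_weight_cat last_rcons.
  by rewrite -(addr0 0) lerD // IH //; lia.
have -> : walk_weight y (rcons s y) =
    walk_weight z (rcons s2 z) + walk_weight y (rcons (s1 ++ z :: s3) y).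
  rewrite Es !rcons_cat !rcons_cons rcons_cat rcons_cons -!cat_rcons.
  by rewrite !walk_weight_cat !last_rcons addrCA.
move: le_s; rewrite Es !size_cat /= !size_cat /= => le_s.
by rewrite -(addr0 0) lerD // IH //; rewrite ?size_cat /=; lia.
Qed.

(** [q y] is the supremum of the weights of walks from [r] to [y]. Closing such a walk at [r] bounds
    it by [- W y r]; prolonging a walk to [x] by the step to [y] gives the inequality. *)
Lemma potential_exists (r : T) :
  exists q : T -> R, forall x y, W x y <= q y - q x.
Proof.
pose A y := [set walk_weight r (rcons s y) | s in [set: seq T]]%classic.
have ubA y : ubound (A y) (- W y r).
  move=> _ [s _ <-]; have := closed_walk_weight_le0 r (rcons s y).
  by rewrite -cats1 walk_weight_cat last_rcons /= addr0 => ?; lra.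
have A0 y : (A y !=set0)%classic by exists (walk_weight r (rcons [::] y)), [::].
exists (fun y => sup (A y)) => x y.
rewrite lerBrDr addrC -lerBrDr; apply: ge_sup => // _ [s _ <-].
rewrite lerBrDr; apply: ub_le_sup; first by exists (- W y r).
exists (rcons s x) => //.
by rewrite -(cats1 (rcons s x)) walk_weight_cat last_rcons /= addr0.
Qed.

End Potentials.

(** * Graphical prices that single out the classes of a colouring *)

Section GraphicalPrices.
Variables (R : realType) (n : nat).
Implicit Types (p : gvec R n) (S : {set 'I_n}).

Lemma dotv_bundle p S : dotv p (bundle_vec R S) =
  \sum_(i in S) p (inl i) + \sum_(e : edge n | val e \subset S) p (inr e).
Proof.
rewrite /dotv big_sumType /=; congr (_ + _); rewrite [RHS]big_mkcond;
  by apply: eq_bigr => x _; rewrite ffunE; case: ifP; rewrite ?mulr1 ?mulr0.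
Qed.

Lemma dotv_bundle0 p : dotv p (bundle_vec R set0) = 0.
Proof.
rewrite dotv_bundle big_set0 add0r big1 // => e.
by rewrite subset0 => /eqP e0; have := valP e; rewrite /= e0 cards0.
Qed.

Lemma norm_dotv_bundle p S : `|dotv p (bundle_vec R S)| <= \sum_c `|p c|.
Proof.
apply: le_trans (ler_norm_sum _ _ _) _; apply: ler_sum => -[i|e] _;
  by rewrite ffunE normrM normr_nat ler_piMr // lern1 leq_b1.
Qed.

(** Double counting of incident pairs of a vertex and an edge: every edge has two endpoints. *)
Lemma sum_edges2 (h : {set 'I_n} -> R) S :
  (\sum_(e : edge n | val e \subset S) h (val e)) *+ 2 =
  \sum_(i in S) \sum_(j in S | j != i) h [set i; j].
Proof.
rewrite -sumrMnl.
transitivity (\sum_(e : edge n | val e \subset S) \sum_(i in val e) h (val e)).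
  by apply: eq_bigr => e _; rewrite sumr_const (eqP (valP e)).
rewrite (exchange_big_dep (mem S)) /=; last first.
  by move=> e i /subsetP; apply.
apply: eq_bigr => i iS.
rewrite -(big_sub_cond [pred e : {set 'I_n} | #|e| == 2%N]
            [pred e : {set 'I_n} | (e \subset S) && (i \in e)] h) /=.
have set2_inj : {in [pred j | (j \in S) && (j != i)] &,
    injective (fun j => [set i; j])}.
  move=> j k /andP[_ /negPf ji] _ /setP/(_ j).
  by rewrite !inE eqxx ji orbT => /esym/eqP.
rewrite -(big_imset _ set2_inj) /=; apply: eq_bigl => e.
apply/idP/imsetP => [/andP[/cards2P[x [y [xy ->]]]]|[j /andP[jS ji] ->]].
  rewrite subUset !sub1set => /andP[/andP[xS yS]]; rewrite !inE => /orP[]/eqP->.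
    by exists y; rewrite // inE yS eq_sym.
  by exists x; rewrite ?inE ?xS // setUC.
by rewrite inE cards2 [i == j]eq_sym ji /= subUset !sub1set iS jS set21.
Qed.

Section ClassPrice.
Variables (K : eqType) (k : 'I_n -> K).

Definition class_of i := [set j | k j == k i].

Definition monochromatic (e : {set 'I_n}) :=
  [forall i in e, [forall j in e, k i == k j]].

Lemma monochromatic2 i j : monochromatic [set i; j] = (k j == k i).
Proof.
apply/forall_inP/idP => [/(_ j (set22 _ _))/forall_inP/(_ i (set21 _ _))//|].
move=> /eqP kji x; rewrite !inE => /orP[]/eqP->; apply/forall_inP => y;
  by rewrite !inE => /orP[]/eqP->; rewrite ?kji.
Qed.

(* Chosen so that its value on a bundle S is the sum over the vertices i of S of
   the size of the symmetric difference of S and the class of i; it vanishes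
   exactly on the classes and the empty bundle. *)
Definition class_price : gvec R n := [ffun c => match c with
  | inl i => #|class_of i|%:R - 1
  | inr e => if monochromatic (val e) then -2 else 2
  end].

Lemma class_price_symdiff S : dotv class_price (bundle_vec R S) =
  \sum_(i in S) (#|S :\: class_of i| + #|class_of i :\: S|)%:R.
Proof.
rewrite dotv_bundle.
(* Half an edge price, so that each endpoint carries an equal share. *)
pose h e : R := if monochromatic e then -1 else 1.
have -> : \sum_(e : edge n | val e \subset S) class_price (inr e) =
    (\sum_(e : edge n | val e \subset S) h (val e)) *+ 2.
  rewrite -sumrMnl; apply: eq_bigr => e _; rewrite ffunE /h.
  by case: ifP; rewrite ?mulNrn.
rewrite sum_edges2 -big_split /=; apply: eq_bigr => i iS; rewrite ffunE.
rewrite (bigID (mem (class_of i))) /=.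
have -> : \sum_(j | (j \in S) && (j != i) && (j \in class_of i)) h [set i; j] =
    - #|(S :&: class_of i) :\ i|%:R.
  rewrite -sumr_const -sumrN; apply: eq_big => [j|j].
    by rewrite !inE andbA [(j != i) && _]andbC.
  by rewrite !inE /h monochromatic2 => /andP[_ ->].
have -> : \sum_(j | (j \in S) && (j != i) && (j \notin class_of i)) h [set i; j] =
    #|S :\: class_of i|%:R.
  rewrite -sumr_const; apply: eq_big => [j|j].
    by rewrite !inE; have [->|] := eqVneq j i; rewrite ?eqxx ?andbF ?andbT // andbC.
  by rewrite !inE /h monochromatic2 => /andP[_ /negPf->].
have := cardsD1 i (S :&: class_of i); rewrite !inE iS eqxx /= => E1.
have E2 := cardsID S (class_of i); rewrite setIC in E2.
rewrite -E2 E1 !natrD; lra.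
Qed.

Lemma class_price_eq0 i : dotv class_price (bundle_vec R (class_of i)) = 0.
Proof.
rewrite class_price_symdiff big1 // => j; rewrite inE => /eqP kj.
by rewrite /class_of kj setDv cards0.
Qed.

(** The price is a sum of natural numbers, and the term of [i] is nonzero. *)
Lemma class_price_ge1 S i : i \in S -> S != class_of i ->
  1 <= dotv class_price (bundle_vec R S).
Proof.
move=> iS neq; rewrite class_price_symdiff (bigD1 i) //=.
rewrite -[leLHS]addr0 lerD //; last by apply: sumr_ge0 => j _; apply: ler0n.
by rewrite ler1n lt0n addn_eq0 !cards_eq0 !setD_eq0 -eqEsubset.
Qed.

End ClassPrice.
End GraphicalPrices.

(** * From potentials on the parts to clearing prices *)

Section ClearingPrice.
Variables (R : realType) (n m : nat) (k : 'I_n -> option 'I_m).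
Variable w : 'I_m -> gvec R n.

Definition part (b : 'I_m) := [set i | k i == Some b].

Let val b S := dotv (w b) (bundle_vec R S).

Lemma part_class b i : i \in part b -> part b = class_of k i.
Proof. by rewrite inE => /eqP ki; apply/setP => j; rewrite !inE ki. Qed.

(* Shifting all potentials makes empty parts free and every agent's surplus
   nonnegative. *)
Lemma normalize_potential (q : 'I_m -> R) :
  (forall b b', val b (part b') - val b (part b) <= q b' - q b) ->
  exists q' : 'I_m -> R,
  [/\ forall b b', val b (part b') - val b (part b) <= q' b' - q' b,
      forall b, part b = set0 -> q' b = 0
    & forall b, 0 <= val b (part b) - q' b].
Proof.
move=> hq; have [b0 /eqP e0|ne] := pickP (fun b => part b == set0).
  exists (fun b => q b - q b0); split=> [b b'|b e|b].
  - by have := hq b b'; lra.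
  - by have := hq b b0; have := hq b0 b; rewrite /val e e0 !dotv_bundle0; lra.
  - by have := hq b b0; rewrite /val e0 dotv_bundle0; lra.
(* With no empty part, lowering all potentials far enough suffices. *)
pose X := \sum_b `|val b (part b) - q b|.
exists (fun b => q b - X); split=> [b b'|b e|b].
- by have := hq b b'; lra.
- by have := ne b; rewrite e eqxx.
have : `|val b (part b) - q b| <= X.
  by rewrite /X (bigD1 b) //= lerDl sumr_ge0.
by rewrite ler_norml => /andP[]; lra.
Qed.

Lemma clearing_price (q : 'I_m -> R) :
  (forall b b', val b (part b') - val b (part b) <= q b' - q b) ->
  exists p : gvec R n, forall b S,
    val b S - dotv p (bundle_vec R S) <=
    val b (part b) - dotv p (bundle_vec R (part b)).
Proof.
move=> /normalize_potential[{}q [hq q0 surplus]].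
pose K := \sum_b \sum_c `|w b c|.
have valK b S : val b S <= K.
  apply: le_trans (ler_norm _) _; apply: le_trans (norm_dotv_bundle _ _) _.
  rewrite /K (bigD1 b) //= lerDl; apply: sumr_ge0 => b' _; exact: sumr_ge0.
have K0 : 0 <= K by apply: sumr_ge0 => b _; apply: sumr_ge0.
(* The potential of a part is spread evenly over its vertices; an unassigned vertex costs [K], at
   least any bundle's value. *)
pose r : gvec R n := [ffun c => match c with
  | inl i => if k i is Some b then q b / #|part b|%:R else K
  | inr _ => 0
  end].
have dot_r S : dotv r (bundle_vec R S) = \sum_(i in S) r (inl i).
  rewrite dotv_bundle [X in _ + X]big1 ?addr0 // => e _; by rewrite ffunE.
(* Large enough that a nonempty bundle other than a class costs at least [K], even after the
   correction by [r]. *)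
pose M := K + \sum_c `|r c|.
pose p : gvec R n := [ffun c => M * class_price R k c + r c].
have dot_p S : dotv p (bundle_vec R S) =
    M * dotv (class_price R k) (bundle_vec R S) + dotv r (bundle_vec R S).
  rewrite /dotv mulr_sumr -big_split /=; apply: eq_bigr => c _.
  by rewrite [p c]ffunE mulrDl mulrA.
have dot_part b : dotv p (bundle_vec R (part b)) = q b.
  rewrite dot_p; have [e|[i ib]] := set_0Vmem (part b).
    by rewrite e !dotv_bundle0 q0 // mulr0 addr0.
  rewrite dot_r {1}(part_class ib) class_price_eq0 mulr0 add0r.
  rewrite (eq_bigr (fun=> q b / #|part b|%:R)) => [|j]; last first.
    by rewrite inE ffunE => /eqP->.
  rewrite sumr_const -[RHS](@divfK _ #|part b|%:R) ?mulr_natr //.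
  by rewrite pnatr_eq0 -lt0n; apply/card_gt0P; exists i.
exists p => b S; rewrite dot_part.
have [->|[i iS]] := set_0Vmem S.
  by rewrite /val !dotv_bundle0 subrr surplus.
have [eS|neS] := eqVneq S (class_of k i).
  (* A class is either the part of some agent or the set of all unassigned vertices. *)
  case ki: (k i) => [b'|].
    have -> : S = part b' by rewrite eS -(@part_class b') // inE ki.
    by rewrite dot_part; have := hq b b'; lra.
  apply: le_trans (surplus b); rewrite dot_p {2}eS class_price_eq0 dot_r.
  have : K <= \sum_(i in S) r (inl i).
    rewrite (bigD1 i) //= ffunE ki lerDl; apply: sumr_ge0 => j /andP[].
    by rewrite eS inE ki ffunE => /eqP->.
  by have := valK b S; lra.
apply: le_trans (surplus b); rewrite dot_p.
have M0 : 0 <= M by apply: addr_ge0 => //; apply: sumr_ge0.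
have := ler_wpM2l M0 (class_price_ge1 R iS neS); rewrite mulr1.
have := norm_dotv_bundle r S; rewrite ler_norml => /andP[+ _].
by have := valK b S; rewrite /M; lra.
Qed.

End ClearingPrice.

(** * Efficient allocations and feasibility *)

Section EfficientAllocation.
Variables (R : realType) (n m : nat) (T : {set 'I_n}).
Implicit Types (w : 'I_m -> gvec R n) (f : {ffun 'I_n -> 'I_m}).

Definition owner f (i : 'I_n) := if i \in T then Some (f i) else None.

Definition welfare w f := \sum_b dotv (w b) (bundle_vec R (part (owner f) b)).

Lemma mem_part_owner f b i : (i \in part (owner f) b) = (i \in T) && (f i == b).
Proof. by rewrite inE /owner; case: (i \in T). Qed.

Lemma efficient_clearing_price (b0 : 'I_m) w f :
  (forall g, welfare w g <= welfare w f) ->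
  exists p : gvec R n, forall b S,
    dotv (w b) (bundle_vec R S) - dotv p (bundle_vec R S) <=
    dotv (w b) (bundle_vec R (part (owner f) b)) -
    dotv p (bundle_vec R (part (owner f) b)).
Proof.
move=> f_max; pose D := part (owner f).
pose W b b' := dotv (w b) (bundle_vec R (D b')) - dotv (w b) (bundle_vec R (D b)).
have W_perm (t : {perm 'I_m}) : \sum_b W b (t b) <= 0.
  (* Under [g] agent [b] receives the part that [f] gives to [t b], whence the inverse. *)
  rewrite sumrB subr_le0; pose g := [ffun i => (t^-1)%g (f i)].
  apply: le_trans (f_max g); rewrite le_eqVlt; apply/orP; left; apply/eqP.
  apply: eq_bigr => b _; congr (dotv _ (bundle_vec _ _)); apply/setP => i.
  by rewrite !mem_part_owner ffunE (canF_eq (permKV t)).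
have [q hq] := potential_exists (fun b => subrr _) W_perm b0.
exact: clearing_price hq.
Qed.

Lemma sum_vertex_proj_part f i :
  (\sum_b bundle_vec R (part (owner f) b)) (inl i) = (i \in T)%:R.
Proof.
rewrite sum_ffunE (bigD1 (f i)) //= ffunE mem_part_owner eqxx andbT.
rewrite big1 ?addr0 // => b ne; rewrite ffunE mem_part_owner eq_sym.
by rewrite (negPf ne) andbF.
Qed.

Variable Sb : 'I_m -> {set 'I_n}.

(* Finite surrogate for the weight -oo on vertices outside [Sb b]. *)
Definition penalized (B : R) w b : gvec R n :=
  [ffun c => w b c - (if c is inl i then B * (i \notin Sb b)%:R else 0)].

Lemma dotv_penalized B w b S : dotv (penalized B w b) (bundle_vec R S) =
  dotv (w b) (bundle_vec R S) - B * #|S :\: Sb b|%:R.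
Proof.
rewrite !dotv_bundle.
rewrite [X in _ + X](eq_bigr (fun e => w b (inr e))) => [|e _]; last first.
  by rewrite ffunE subr0.
rewrite (eq_bigr (fun i => w b (inl i) - B * (i \notin Sb b)%:R)); last first.
  by move=> i _; rewrite ffunE.
rewrite sumrB -mulr_sumr -addrA [- _ + _]addrC addrA; congr (_ - _ * _).
rewrite -natr_sum -sum1_card; congr _%:R.
rewrite [RHS]big_mkcond [LHS]big_mkcond; apply: eq_bigr => i _.
by rewrite inE; case: (i \in S); case: (i \in Sb b).
Qed.

(** A maximizer of penalized welfare must be feasible: [f0] pays no penalty, and a single misplaced
    vertex costs [B], more than the spread of welfare. *)
Lemma efficient_feasible w (f0 : {ffun 'I_n -> 'I_m}) :
  (forall i, i \in Sb (f0 i)) ->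
  exists B f, [/\ forall g, welfare (penalized B w) g <= welfare (penalized B w) f
    & forall b, part (owner f) b \subset Sb b].
Proof.
(* Welfare lies between [- K] and [K], so any penalty above [K + K] works. *)
move=> hf0; pose K := \sum_b \sum_c `|w b c|; pose B := K + K + 1.
have K0 : 0 <= K by apply: sumr_ge0 => b _; apply: sumr_ge0.
have wK f : `|welfare w f| <= K.
  apply: le_trans (ler_norm_sum _ _ _) _; apply: ler_sum => b _.
  exact: norm_dotv_bundle.
have welfareB f : welfare (penalized B w) f =
    welfare w f - B * (\sum_b #|part (owner f) b :\: Sb b|)%:R.
  rewrite /welfare natr_sum mulr_sumr -sumrB.
  by apply: eq_bigr => b _; rewrite dotv_penalized.
pose f := [arg max_(g > f0) welfare (penalized B w) g]%O.
have f_max g : welfare (penalized B w) g <= welfare (penalized B w) f.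
  by rewrite /f; case: arg_maxP => // h _ /(_ g isT).
exists B, f; split=> // b; rewrite -setD_eq0 -cards_eq0.
apply: contraT; rewrite -lt0n => infeasible.
have := f_max f0; rewrite !welfareB [in X in _ - _ * X%:R <= _]big1; last first.
  move=> b' _; apply/eqP; rewrite cards_eq0 setD_eq0; apply/subsetP => i.
  by rewrite mem_part_owner => /andP[_ /eqP<-].
have : (1 : R) <= (\sum_b #|part (owner f) b :\: Sb b|)%:R.
  by rewrite ler1n (bigD1 b) //= addn_gt0 infeasible.
have B0 : 0 <= B by rewrite /B; lra.
move=> /(ler_wpM2l B0); have := wK f; have := wK f0.
by rewrite !ler_norml /B => /andP[? ?] /andP[? ?]; lra.
Qed.

End EfficientAllocation.

(** * Existence of the equilibrium *)

Theorem theorem3p4 (R : realType) (n m : nat) (hn : (1 <= n)%N) (hm : (1 <= m)%N)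
    (v : 'I_m -> {set 'I_n} -> \bar R) (Sb : 'I_m -> {set 'I_n})
    (hv : forall b : 'I_m, bids_on_clique (v b) (Sb b))
    (hcover : (\bigcup_(b < m) Sb b)%SET = [set: 'I_n]%SET)
    (astar : {ffun 'I_n -> R})
    (hastar : forall i : 'I_n, astar i = 0 \/ astar i = 1) :
  has_graphical_equilibrium v astar.
Proof.
have /choice[w hw] := hv.
have /choice[f0 hf0] (i : 'I_n) : exists b, i \in Sb b.
  have : i \in [set: 'I_n]%SET by rewrite inE.
  by rewrite -hcover => /bigcupP[b _ ib]; exists b.
pose T := [set i | astar i == 1].
have [|B [f [f_max feasible]]] := @efficient_feasible _ _ _ T Sb w (finfun f0).
  by move=> i; rewrite ffunE.
have [p hp] := efficient_clearing_price (Ordinal hm) f_max.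
exists p, (fun b => bundle_vec R (part (owner T f) b)); split.
- by move=> b; exists (part (owner T f) b).
- move=> b; exists (part (owner T f) b) => // S.
  (* Bundles outside the clique have utility [-oo]; inside it the penalty vanishes, so the penalized
     comparison is the true one. *)
  rewrite /utility !hw feasible; case: ifP => [SSb|_]; last by rewrite leNye.
  have := hp b S; rewrite !dotv_penalized.
  move: SSb (feasible b); rewrite -!setD_eq0 => /eqP-> /eqP->.
  rewrite cards0 mulr0 !subr0.
  by rewrite -!EFinB lee_fin !dotv_bundle.
apply/ffunP => i; rewrite ffunE sum_vertex_proj_part inE.
by case: (hastar i) => ->; rewrite ?eqxx // eq_sym oner_eq0.
Qed.
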